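(* For every $n\in\mathbb Z$ and every $j\in\{0,1,\dots,r+1\}$, $$c_j=Z_j^{(G_r)}\bigl(y_{1,n},y_{2,n},\dots,y_{2r+1,n}\bigr),$$ where $c_j$ are the conserved quantities defined below. In particular, taking $n=0$, $c_j$ is the $j$-particle hard particle partition function on $G_r$ with vertex weights $y_{2\alpha-1}=\frac{R_{\alpha-1,0}R_{\alpha,1}}{R_{\alpha,0}R_{\alpha-1,1}}$ ($1\le\alpha\le r+1$) and $y_{2\alpha}=\frac{R_{\alpha-1,0}R_{\alpha+1,1}}{R_{\alpha,0}R_{\alpha,1}}$ ($1\le\alpha\le r$).
   Context: Fix $r\ge1$, $I_r=\{1,\dots,r\}$. Let $R_{1,0},\dots,R_{r,0},R_{1,1},\dots,R_{r,1}$ be algebraically independent indeterminates over $\mathbb Q$ and $(R_{\alpha,n})_{0\le\alpha\le r+1,n\in\mathbb Z}$ the $A_r$ $Q$-system: the unique family of nonzero elements of $\mathbb Q(R_{1,0},\dots,R_{r,1})$ with these initial values, $R_{0,n}=R_{r+1,n}=1$, and $R_{\alpha,n+1}R_{\alpha,n-1}=R_{\alpha,n}^2+R_{\alpha+1,n}R_{\alpha-1,n}$ ($\alpha\in I_r$, $n\in\mathbb Z$). Conserved quantities: for $k\in\{0,\dots,r+1\}$, $c_k$ is the determinant of the matrix obtained from the $(r+2)\times(r+2)$ matrix $(R_{1,n+i+j-r-3})_{1\le i,j\le r+2}$ by deleting row $r+2$ and column $r+2-k$; this is independent of $n$. Weights: $y_{2\alpha-1,n}=\frac{R_{\alpha-1,n}R_{\alpha,n+1}}{R_{\alpha,n}R_{\alpha-1,n+1}}$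 for $1\le\alpha\le r+1$ and $y_{2\alpha,n}=\frac{R_{\alpha-1,n}R_{\alpha+1,n+1}}{R_{\alpha,n}R_{\alpha,n+1}}$ for $1\le\alpha\le r$. The graph $G_r$ has vertices $1,\dots,2r+1$ and edges $\{1,2\}$, $\{2k,2k+1\}$ for $1\le k\le r$, and $\{2k-2,2k\}$, $\{2k-1,2k\}$ for $2\le k\le r$. A hard particle configuration on a graph is a set of vertices no two of which are joined by an edge. Given vertex weights $y_1,\dots,y_{2r+1}$, the weight of a configuration $C$ is $\prod_{i\in C}y_i$; $Z_j^{(G_r)}(y_1,\dots,y_{2r+1})$ denotes the sum of the weights of all hard particle configurations on $G_r$ of cardinality $j$. *)

(* Defs.v *)
From HB Require Import structures.
From mathcomp Require Import all_boot all_order all_algebra.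
Set Implicit Arguments. Unset Strict Implicit. Unset Printing Implicit Defensive.
Import Order.TTheory GRing.Theory Num.Theory.
Local Open Scope ring_scope.

Fixpoint mpoly (m : nat) : idomainType :=
  if m is m'.+1 then ({poly mpoly m'} : idomainType) else (rat : idomainType).

Fixpoint mvar (m i : nat) : mpoly m :=
  match m return mpoly m with
  | 0 => 0
  | m'.+1 => if i == m' then 'X else (mvar m' i)%:P
  end.

Definition ratfun (m : nat) : fieldType := {fraction (mpoly m)}.

Definition xvar (m i : nat) : ratfun m := FracField.tofrac (mvar m i).

(* Edges of G_r on vertices 1..2r+1 (1-based), oriented as listed in the
   paper: {1,2}, {2k,2k+1} (1<=k<=r), {2k-2,2k}, {2k-1,2k} (2<=k<=r). *)
Definition Gedge (r a b : nat) : bool :=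
  [|| (a == 1%N) && (b == 2%N),
      [exists k : 'I_r.+1, [&& (1 <= k)%N, a == (2 * k)%N & b == (2 * k).+1]],
      [exists k : 'I_r.+1, [&& (2 <= k)%N, a == (2 * k - 2)%N & b == (2 * k)%N]]
    | [exists k : 'I_r.+1, [&& (2 <= k)%N, a == (2 * k - 1)%N & b == (2 * k)%N]]].

Definition Gadj (r a b : nat) : bool := Gedge r a b || Gedge r b a.

(* Vertex v : 'I_(2r+1) stands for vertex v+1 of G_r.
   A hard particle configuration: no two of its vertices are adjacent. *)
Definition hard_particle (r : nat) (C : {set 'I_(2 * r).+1}) : bool :=
  [forall u in C, forall v in C, ~~ Gadj r u.+1 v.+1].

(* Z_j^{(G_r)}(y_1, ..., y_{2r+1}), with y given as a function of the
   1-based vertex label. *)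
Definition Zhard (K : fieldType) (r j : nat) (y : nat -> K) : K :=
  \sum_(C : {set 'I_(2 * r).+1} | hard_particle C && (#|C| == j))
     \prod_(v in C) y v.+1.

Definition yweight (K : fieldType) (R : nat -> int -> K) (n : int) (v : nat) : K :=
  if odd v then
    let a := v.+1./2 in
    R a.-1 n * R a (n + 1) / (R a n * R a.-1 (n + 1))
  else
    let a := v./2 in
    R a.-1 n * R a.+1 (n + 1) / (R a n * R a (n + 1)).

(* c_k computed at time n: the determinant of the (r+2)x(r+2) matrix
   (R_{1, n+i+j-r-3})_{1<=i,j<=r+2} with row r+2 and column r+2-k deleted.
   With 0-based indices, row i (0<=i<=r) and the kept columns are
   lift j0 j where j0 = r+1-k is the deleted (0-based) column. *)
Definition cons_qty (K : fieldType) (R : nat -> int -> K) (r k : nat) (n : int) : K :=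
  let j0 : 'I_(r.+2) := inord (r.+1 - k) in
  \det (\matrix_(i < r.+1, j < r.+1)
          R 1%N (n + (i%:Z) + ((lift j0 j : nat)%:Z) - (r%:Z) - 1)).

(* Main.v *)
Require Import Defs.
From HB Require Import structures.
From mathcomp Require Import all_boot all_order all_algebra.
From mathcomp Require Import ring zify.
Import Order.TTheory GRing.Theory Num.Theory.
Local Open Scope ring_scope.

Set Implicit Arguments.
Unset Strict Implicit.
Unset Printing Implicit Defensive.

(** Let [F_a^(n)] be the generating polynomial of hard particles on the vertices
    [1, ..., 2a-1] with weights [y_{i,n}]. Removing the last two vertices gives
    [F_{a+1} = (1 + y_{2a+1} X) F_a + y_{2a} X F_{a-1}], and the Q-system turns
    this into the time evolution [F_a^(n+1) = F_a^(n) + y_{2a,n} X F_{a-1}^(n)].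
    With [R_{r+2} = 0] the last term vanishes for [a = r+1], so [F_{r+1}] is
    conserved. Pairing a polynomial [p] with [R_1] by
    [L_m(p) = sum_k (-1)^k p_k R_{1,m-k}], the two recursions show that
    [L_m(F_a^(n))] vanishes for [n < m <= n+a] and is a ratio of [R]'s at
    [m = n] and [m = n+a+1]. Hence the Hankel matrix of [R_1], multiplied by the
    unitriangular matrix of coefficients of the [F_a], becomes triangular, so
    its determinant of size [r+1] is [R_{r+1} = 1]; and the coefficients of
    [F_{r+1}], up to sign, span the kernel of the [(r+1) x (r+2)] Hankel matrix,
    whose maximal minors [c_j] are therefore proportional to them. *)

Lemma big_subset_setU1 (R : Type) (idx : R) (op : Monoid.com_law idx)
    (T : finType) (v : T) (A : {set T}) (F : {set T} -> R) : v \notin A ->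
  \big[op/idx]_(C : {set T} | C \subset v |: A) F C =
  op (\big[op/idx]_(C : {set T} | C \subset A) F C)
     (\big[op/idx]_(C : {set T} | C \subset A) F (v |: C)).
Proof.
move=> vA.
have subU1 (C : {set T}) :
    (C \subset v |: A) && (v \notin C) = (C \subset A).
  by rewrite -subsetD1 setU1K.
rewrite (bigID (fun C : {set T} => v \in C)) Monoid.mulmC; congr (op _ _).
  by apply: eq_bigl => C; rewrite subU1.
rewrite (reindex_onto (fun C => v |: C) (fun C => C :\ v)); last first.
  by move=> C /andP[_ vC]; rewrite setD1K.
apply: eq_bigl => C; rewrite -subU1 setU11 andbT subUset sub1set setU11.
congr (_ && _); apply/eqP/idP => [<-|]; first by rewrite setD11.
exact: setU1K.
Qed.

Lemma int_shift_invariant (T : Type) (f : int -> T) :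
  (forall n, f (n + 1) = f n) -> forall m n, f m = f n.
Proof.
move=> f_shift; suff f_eq0 n : f n = f 0 by move=> m n; rewrite !f_eq0.
elim/int_rect: n => [//|n <-|n <-]; first by rewrite intS addrC f_shift.
by rewrite -f_shift intS opprD addrAC addNr add0r.
Qed.

Section IndependentSets.

Variables (T : finType) (adj : rel T).

Definition independent (C : {set T}) : bool :=
  [forall u in C, forall v in C, ~~ adj u v].

Lemma independentP (C : {set T}) :
  reflect {in C &, forall u v, ~~ adj u v} (independent C).
Proof.
by apply: (iffP 'forall_in_forall_inP) => indC u => [v uC|uC v]; apply: indC.
Qed.

Lemma independent0 : independent set0.
Proof. by apply/independentP => u v; rewrite inE. Qed.

Definition indep_sum (S : comNzRingType) (w : T -> S) (A : {set T}) : S :=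
  \sum_(C : {set T} | (C \subset A) && independent C) \prod_(v in C) w v.

Lemma indep_sum0 (S : comNzRingType) (w : T -> S) : indep_sum w set0 = 1.
Proof.
rewrite /indep_sum (big_pred1 set0) ?big_set0 // => C; rewrite subset0 /=.
by case: eqVneq => // ->; rewrite independent0.
Qed.

Lemma coef_indep_sum_scaleX (S : comNzRingType) (y : T -> S) (A : {set T}) j :
  (indep_sum (fun v => y v *: 'X) A)`_j =
  \sum_(C : {set T} | [&& C \subset A, independent C & #|C| == j])
     \prod_(v in C) y v.
Proof.
rewrite /indep_sum coef_sum.
under [RHS]eq_bigl => C do rewrite andbA.
rewrite [RHS]big_mkcondr; apply: eq_bigr => C _.
rewrite scaler_prod prodr_const coefZ coefXn eq_sym.
by case: eqP => _; rewrite ?mulr1 ?mulr0.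
Qed.

Hypotheses (adj_sym : symmetric adj) (adj_irr : irreflexive adj).

Lemma independentU1 (v : T) (C : {set T}) :
  independent (v |: C) = independent C && [forall u in C, ~~ adj u v].
Proof.
apply/independentP/andP => [indvC|[/independentP indC /forall_inP nadj] u w].
  split; first by apply/independentP => u w uC wC; apply: indvC; apply: setU1r.
  by apply/forall_inP => u uC; apply: indvC; rewrite ?setU11 ?setU1r.
case/setU1P=> [->|uC] /setU1P[->|wC]; last exact: indC.
- by rewrite adj_irr.
- by rewrite adj_sym nadj.
- exact: nadj.
Qed.

Lemma indep_sum_setU1 (S : comNzRingType) (w : T -> S) (v : T) (A : {set T}) :
  v \notin A ->
  indep_sum w (v |: A) =
  indep_sum w A + w v * indep_sum w [set u in A | ~~ adj u v].
Proof.
move=> vA; rewrite /indep_sum big_mkcondr (big_subset_setU1 _ _ vA) /=.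
rewrite -!big_mkcondr big_distrr; congr (_ + _); apply: eq_big => [C|C].
  rewrite independentU1 setIdE subsetI [RHS]andbAC andbA.
  congr (_ && _); apply/forall_inP/subsetP => nadj u uC.
    by rewrite inE nadj.
  by have := nadj u uC; rewrite inE.
case/andP=> /subsetP CA _; rewrite big_setU1 //.
by apply: contra vA => /CA.
Qed.

End IndependentSets.

Lemma indep_sum_initial_recr (S : comNzRingType) (p : nat) (adj : rel 'I_p)
    (w : 'I_p -> S) (v : 'I_p) (k : nat) :
    symmetric adj -> irreflexive adj -> (k <= v)%N ->
    (forall u : 'I_p, (u < v)%N -> ~~ adj u v = (u < k)%N) ->
  indep_sum adj w [set u : 'I_p | (u < v.+1)%N] =
  indep_sum adj w [set u : 'I_p | (u < v)%N] +
    w v * indep_sum adj w [set u : 'I_p | (u < k)%N].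
Proof.
move=> adj_sym adj_irr kv nadjE.
have -> : [set u : 'I_p | (u < v.+1)%N] = v |: [set u : 'I_p | (u < v)%N].
  by apply/setP => u; rewrite !inE ltnS leq_eqVlt.
rewrite indep_sum_setU1 ?inE ?ltnn //; congr (_ + _ * indep_sum _ _ _).
apply/setP => u; rewrite !inE.
by case: (ltnP u v) => [/nadjE //|vu]; rewrite ltnNge (leq_trans kv vu).
Qed.

Section HardParticlePolynomial.

Variable S : comNzRingType.
Implicit Types (y z : nat -> S) (a : nat).

Fixpoint hp_poly y a : {poly S} :=
  match a with
  | 0 => 1
  | 1 => 1 + y 1%N *: 'X
  | (b.+1 as c).+1 =>
      hp_poly y c + y c.*2 *: 'X * hp_poly y b + y c.*2.+1 *: 'X * hp_poly y c
  end.

Lemma hp_polySS y a :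
  hp_poly y a.+2 = hp_poly y a.+1 + y a.+1.*2 *: 'X * hp_poly y a
                   + y a.+1.*2.+1 *: 'X * hp_poly y a.+1.
Proof. by []. Qed.

Lemma coef0_hp_poly y a : (hp_poly y a)`_0 = 1.
Proof.
elim/ltn_ind: a => -[|[|a]] IH; rewrite ?hp_polySS !coefE ?mulr0 ?addr0 //.
by rewrite -!scalerAl !coefZ !coefXM !mulr0 !addr0 IH.
Qed.

Lemma size_scaleX_mul (b : S) (p : {poly S}) :
  (size (b *: 'X * p)%R <= (size p).+1)%N.
Proof.
rewrite -scalerAl (leq_trans (size_scale_leq _ _)) //.
by rewrite (leq_trans (size_polyMleq _ _)) // size_polyX.
Qed.

Lemma size_polyD_leq (p q : {poly S}) d :
  (size p <= d -> size q <= d -> size (p + q)%R <= d)%N.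
Proof. by move=> sp sq; rewrite (leq_trans (size_polyD _ _)) // geq_max sp. Qed.

Lemma size_hp_poly y a : (size (hp_poly y a) <= a.+1)%N.
Proof.
have size_scaleX b (p : {poly S}) d :
    (size p <= d)%N -> (size (b *: 'X * p)%R <= d.+1)%N.
  by move=> ?; apply: leq_trans (size_scaleX_mul _ _) _.
elim/ltn_ind: a => -[|[|a]] IH; rewrite ?hp_polySS.
- by rewrite size_poly1.
- apply: size_polyD_leq; first by rewrite size_poly1.
  by rewrite -[_ *: 'X]mulr1 size_scaleX ?size_poly1.
apply: size_polyD_leq; last by apply: size_scaleX; apply: IH.
by apply: size_polyD_leq; [|apply: size_scaleX]; apply: leqW; apply: IH.
Qed.

Section Evolution.

Variables (r : nat) (y z : nat -> S).
Hypothesis weight_sum0 : z 1%N = y 1%N + y 2.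
Hypothesis weight_sum : forall a, (a < r)%N ->
  z a.+1.*2 + z a.+1.*2.+1 = y a.+1.*2.+1 + y a.+2.*2.
Hypothesis weight_mul : forall a, (a < r)%N ->
  z a.+1.*2.+1 * y a.+1.*2 = z a.+1.*2 * y a.*2.+1.

Lemma hp_poly_evolve a : (a <= r)%N ->
  hp_poly z a.+1 = hp_poly y a.+1 + y a.+1.*2 *: 'X * hp_poly y a /\
  hp_poly y a.+1 = hp_poly z a + y a.*2.+1 *: 'X * hp_poly y a.
Proof.
elim: a => [|a IH] ar; first by rewrite /= weight_sum0 scalerDl !mulr1 addrA.
have [evolve peel] := IH (ltnW ar).
split; last by rewrite hp_polySS -evolve.
have sumE := congr1 polyC (weight_sum ar).
have mulE := congr1 polyC (weight_mul ar).
rewrite !(polyCD, polyCM) in sumE mulE.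
rewrite !hp_polySS evolve -[hp_poly z a](addrK (y a.*2.+1 *: 'X * hp_poly y a)).
rewrite -peel -!mul_polyC; apply/eqP; rewrite -subr_eq0; apply/eqP.
set ze := (z a.+1.*2)%:P; set zo := (z a.+1.*2.+1)%:P.
transitivity ((ze + zo - ((y a.+1.*2.+1)%:P + (y a.+2.*2)%:P)) * 'X
    * hp_poly y a.+1
  + (zo * (y a.+1.*2)%:P - ze * (y a.*2.+1)%:P) * 'X ^+ 2 * hp_poly y a).
  by ring.
by rewrite sumE mulE !subrr !mul0r addr0.
Qed.

End Evolution.

End HardParticlePolynomial.

Section Graph.

Variable r : nat.

Lemma GedgeE u v : Gedge r u v =
  (u == 1)%N && (v == 2)%N
  || (2 < v <= r.*2.+1)%N && (u < v <= u + (2 - odd v))%N.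
Proof.
rewrite /Gedge; apply/or4P/orP => [[]|[|uv]]; first by left.
1-3: by case/existsP=> k /and3P[? /eqP-> /eqP->]; have := ltn_ord k; lia.
  by constructor.
have half_lt : (v./2 < r.+1)%N by lia.
have [v_odd|v_even] := boolP (odd v).
  by apply: Or42; apply/existsP; exists (Ordinal half_lt) => /=; lia.
have [v_succ|v_nsucc] := eqVneq v u.+1.
  by apply: Or44; apply/existsP; exists (Ordinal half_lt) => /=; lia.
by apply: Or43; apply/existsP; exists (Ordinal half_lt) => /=; lia.
Qed.

Lemma Gadj_sym : symmetric (Gadj r).
Proof. by move=> u v; rewrite /Gadj orbC. Qed.

Lemma Gadj_irr : irreflexive (Gadj r).
Proof. by move=> u; rewrite /Gadj orbb GedgeE; lia. Qed.

Lemma Gadj_ltn u v : (0 < u < v)%N -> (v <= r.*2.+1)%N ->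
  Gadj r u v = (v <= u + (2 - odd v))%N.
Proof. by rewrite /Gadj !GedgeE; lia. Qed.

Section Polynomial.

Variables (K : fieldType) (y : nat -> K).

Let adj : rel 'I_(2 * r).+1 := fun u v => Gadj r u.+1 v.+1.

Let partial_sum (k : nat) : {poly K} :=
  indep_sum adj (fun v => y v.+1 *: 'X) [set u : 'I_(2 * r).+1 | (u < k)%N].

Let partial_sum_recr k : (k <= 2 * r)%N ->
  partial_sum k.+1 =
  partial_sum k + y k.+1 *: 'X * partial_sum (k - (odd k).+1).
Proof.
move=> kr; have k_ord : (k < (2 * r).+1)%N by [].
apply: (@indep_sum_initial_recr _ _ adj _ (Ordinal k_ord)).
- by move=> u v; apply: Gadj_sym.
- by move=> u; apply: Gadj_irr.
- exact: leq_subr.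
- by move=> u /= uk; rewrite /adj Gadj_ltn /=; lia.
Qed.

Let partial_sum_hp_poly a : (a <= r.+1)%N -> partial_sum a.*2.-1 = hp_poly y a.
Proof.
have partial_sum0 : partial_sum 0 = 1.
  have no_ord : [set u : 'I_(2 * r).+1 | (u < 0)%N] = set0.
    by apply/setP => u; rewrite !inE.
  by rewrite /partial_sum no_ord indep_sum0.
elim/ltn_ind: a => -[|[|a]] IH ar //.
  by rewrite partial_sum_recr // partial_sum0 mulr1.
rewrite hp_polySS -!IH ?(ltnW ar) ?(ltnW (ltnW ar)) // !doubleS /=.
rewrite 2?partial_sum_recr; [|lia..].
by rewrite /= odd_double !subSS subn0 subn1.
Qed.

Lemma Zhard_hp_poly j : Zhard r j y = (hp_poly y r.+1)`_j.
Proof.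
rewrite -partial_sum_hp_poly // coef_indep_sum_scaleX.
have all_ord : [set u : 'I_(2 * r).+1 | (u < r.+1.*2.-1)%N] = setT.
  by apply/setP => u; rewrite !inE; have := ltn_ord u; lia.
by apply: eq_bigl => C; rewrite all_ord subsetT.
Qed.

End Polynomial.

End Graph.

Section ShiftPairing.

Variables (S : comNzRingType) (x : int -> S).
Implicit Types (p q : {poly S}) (m : int).

Definition shift_pairing p m : S :=
  \sum_(k < size p) (-1) ^+ k * p`_k * x (m - k%:Z).

Lemma shift_pairing_wide d p m : (size p <= d)%N ->
  shift_pairing p m = \sum_(k < d) (-1) ^+ k * p`_k * x (m - k%:Z).
Proof.
move=> sp; rewrite /shift_pairing.
rewrite (big_ord_widen _ (fun k => (-1) ^+ k * p`_k * x (m - k%:Z)) sp).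
rewrite big_mkcond; apply: eq_bigr => k _.
by case: ltnP => // /(nth_default 0) ->; rewrite mulr0 mul0r.
Qed.

Lemma shift_pairing1 m : shift_pairing 1 m = x m.
Proof.
by rewrite /shift_pairing size_poly1 big_ord1 coefC expr0 !mul1r subr0.
Qed.

Lemma shift_pairingD p q m :
  shift_pairing (p + q) m = shift_pairing p m + shift_pairing q m.
Proof.
pose d := maxn (size p) (size q).
rewrite !(@shift_pairing_wide d) ?leq_maxl ?leq_maxr ?size_polyD // -big_split.
by apply: eq_bigr => k _; rewrite coefD mulrDr mulrDl.
Qed.

Lemma shift_pairing_scaleX (b : S) p m :
  shift_pairing (b *: 'X * p) m = - b * shift_pairing p (m - 1).
Proof.
rewrite (shift_pairing_wide _ (size_scaleX_mul b p)) -scalerAl.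
rewrite big_ord_recl coefZ coefXM !(mulr0, mul0r) add0r mulr_sumr.
apply: eq_bigr => k _; rewrite coefZ coefXM lift0 /= exprS.
have -> : m - k.+1%:Z = m - 1 - k%:Z by lia.
by ring.
Qed.

Definition alt_rev_coef p (k j : nat) : S :=
  if (j <= k)%N then (-1) ^+ (k - j) * p`_(k - j) else 0.

Lemma sum_alt_rev_coef d k p m : (size p <= k.+1)%N -> (k < d)%N ->
  \sum_(j < d) x (m + j%:Z) * alt_rev_coef p k j = shift_pairing p (m + k%:Z).
Proof.
move=> sp kd; rewrite (shift_pairing_wide _ sp) [RHS](reindex_inj rev_ord_inj).
pose summand (j : nat) := x (m + j%:Z) * alt_rev_coef p k j.
transitivity (\sum_(j < k.+1) summand j).
  rewrite (big_ord_widen _ summand kd) [RHS]big_mkcond; apply: eq_bigr => j _.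
  by rewrite /summand /alt_rev_coef ltnS; case: leqP => // _; rewrite mulr0.
apply: eq_bigr => j _.
rewrite /summand /alt_rev_coef -ltnS ltn_ord mulrC /= subSS.
by congr (_ * x _); have := ltn_ord j; lia.
Qed.

End ShiftPairing.

Definition hankel (S : Type) (x : int -> S) (s : int) (m n : nat) :
  'M[S]_(m, n) :=
  \matrix_(i, j) x (s + i%:Z + j%:Z).

Lemma det_hankel_orthogonal (S : comNzRingType) (x : int -> S) (s : int)
    (n : nat) (p : nat -> {poly S}) :
    (forall k, (k < n)%N -> (size (p k) <= k.+1)%N /\ (p k)`_0 = 1) ->
    (forall i k, (i < k < n)%N ->
       shift_pairing x (p k) (s + i%:Z + k%:Z) = 0) ->
  \det (hankel x s n n) =
  \prod_(k < n) shift_pairing x (p k) (s + k%:Z + k%:Z).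
Proof.
move=> p_unitri p_orth.
pose U : 'M[S]_n := \matrix_(j, k) alt_rev_coef (p k) k j.
have detU : \det U = 1.
  rewrite -det_tr det_trig.
    rewrite big1 // => k _; have [_ p0] := p_unitri k (ltn_ord k).
    by rewrite !mxE /alt_rev_coef leqnn subnn mul1r p0.
  by apply/is_trig_mxP => k j kj; rewrite !mxE /alt_rev_coef leqNgt kj.
have hankelU i k : (hankel x s n n *m U) i k
                 = shift_pairing x (p k) (s + i%:Z + k%:Z).
  have [sp _] := p_unitri k (ltn_ord k).
  rewrite mxE -(sum_alt_rev_coef x _ sp (ltn_ord k)).
  by apply: eq_bigr => j _; rewrite !mxE.
have -> : \det (hankel x s n n) = \det (hankel x s n n *m U).
  by rewrite det_mulmx detU mulr1.
rewrite det_trig; last first.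
  by apply/is_trig_mxP => i k ik; rewrite hankelU p_orth ?ik ?ltn_ord.
by apply: eq_bigr => k _; rewrite hankelU.
Qed.

(* Border [M] by the [j]-th unit row to get [A], so that [A *m v] is [v j 0]
   times the first unit column; multiplying by the adjugate of [A] turns this
   into the claim, the minors of [M] being cofactors along that row. *)
Lemma mulmx0_minors (S : comNzRingType) n (M : 'M[S]_(n, n.+1))
    (v : 'cV[S]_n.+1) (j k : 'I_n.+1) : M *m v = 0 ->
  (-1) ^+ j * \det (col' j M) * v k 0 = (-1) ^+ k * \det (col' k M) * v j 0.
Proof.
move=> Mv0; pose A : 'M_n.+1 :=
  \matrix_(i, l) if unlift 0 i is Some i' then M i' l else (l == j)%:R.
have A0 l : A 0 l = (l == j)%:R by rewrite mxE unlift_none.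
have A_lift i l : A (lift 0 i) l = M i l by rewrite mxE liftK.
have sum_A0 (f : 'I_n.+1 -> S) : \sum_l A 0 l * f l = f j.
  rewrite (bigD1 j) //= A0 eqxx mul1r big1 ?addr0 // => l /negbTE lj.
  by rewrite A0 lj mul0r.
have cofA l : cofactor A 0 l = (-1) ^+ l * \det (col' l M).
  by congr (_ * \det _); apply/matrixP => a b; rewrite !mxE liftK.
have detA : \det A = (-1) ^+ j * \det (col' j M).
  by rewrite (expand_det_row A 0) sum_A0 cofA.
have Av : A *m v = v j 0 *: delta_mx 0 0.
  apply/colP => i; rewrite !mxE; case: (unliftP 0 i) => [a|] ->.
    rewrite eq_sym (negbTE (neq_lift _ _)) mulr0.
    under eq_bigr => l _ do rewrite A_lift.
    by have /colP/(_ a) := Mv0; rewrite !mxE.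
  by rewrite sum_A0 !eqxx mulr1.
have /colP/(_ k) := mulmxA (\adj A) A v.
rewrite mul_adj_mx mul_scalar_mx Av -scalemxAr -colE !mxE cofA detA => <-.
by rewrite mulrC.
Qed.

Lemma det_col'_hankel (S : comNzRingType) (x : int -> S) (s : int) (n : nat)
    (p : {poly S}) (j : 'I_n.+1) :
    (size p <= n.+1)%N -> p`_0 = 1 ->
    (forall i, (i < n)%N -> shift_pairing x p (s + i%:Z + n%:Z) = 0) ->
  \det (col' j (hankel x s n n.+1)) = p`_(n - j) * \det (hankel x s n n).
Proof.
move=> sp p0 p_orth; pose v : 'cV[S]_n.+1 := \col_l alt_rev_coef p n l.
have kerv : hankel x s n n.+1 *m v = 0.
  apply/colP => i; rewrite !mxE -[RHS](p_orth i) //.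
  rewrite -(sum_alt_rev_coef x _ sp (ltnSn n)).
  by apply: eq_bigr => l _; rewrite !mxE.
have v_max : v ord_max 0 = 1 by rewrite mxE /alt_rev_coef leqnn subnn mul1r.
have vj : v j 0 = (-1) ^+ (n - j) * p`_(n - j).
  by rewrite mxE /alt_rev_coef -ltnS ltn_ord.
have col'_max : col' ord_max (hankel x s n n.+1) = hankel x s n n.
  by apply/matrixP => i l; rewrite !mxE lift_max.
have := mulmx0_minors j ord_max kerv; rewrite v_max vj col'_max mulr1 => minors.
have sign_n : (-1) ^+ n = (-1) ^+ j * (-1) ^+ (n - j) :> S.
  by rewrite -exprD subnKC // -ltnS.
apply: (can_inj (signrMK j)); rewrite minors [X in X * _]/= sign_n -!mulrA.
by rewrite (mulrCA (\det _)) signrMK (mulrC (\det _)).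
Qed.

Section QSystem.

Variables (K : fieldType) (r : nat) (R : nat -> int -> K).
Hypothesis R0 : forall n, R 0%N n = 1.
Hypothesis R_neq0 : forall a n, (a <= r.+1)%N -> R a n != 0.
Hypothesis R_zero : forall n, R r.+2 n = 0.
Hypothesis R_rec : forall a n, (1 <= a <= r.+1)%N ->
  R a (n + 1) * R a (n - 1) = R a n ^+ 2 + R a.+1 n * R a.-1 n.

Local Notation y n := (yweight R n).
Local Notation F a n := (hp_poly (yweight R n) a).
Local Notation pairing := (shift_pairing (R 1%N)).

Lemma Qsystem_next a n : (a <= r)%N ->
  R a.+2 (n + 1) * R a (n + 1) =
  R a.+1 (n + 1 + 1) * R a.+1 n - R a.+1 (n + 1) ^+ 2.
Proof.
move=> ar; have := @R_rec a.+1 (n + 1) ar; rewrite addrK => ->.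
by rewrite [RHS]addrC addKr.
Qed.

Lemma yweight_odd a n :
  y n a.*2.+1 = R a n * R a.+1 (n + 1) / (R a.+1 n * R a (n + 1)).
Proof. by rewrite /yweight /= odd_double /= doubleK. Qed.

Lemma yweight_even a n :
  y n a.+1.*2 = R a n * R a.+2 (n + 1) / (R a.+1 n * R a.+1 (n + 1)).
Proof. by rewrite /yweight odd_double /= doubleK. Qed.

Lemma yweight_sum a n : (a <= r)%N ->
  y n a.*2.+1 + y n a.+1.*2 =
  R a n * R a.+1 (n + 1 + 1) / (R a (n + 1) * R a.+1 (n + 1)).
Proof.
move=> ar; have Ra : R a (n + 1) != 0 by rewrite R_neq0 // ltnW.
rewrite yweight_odd yweight_even -(mulfK Ra (R a.+2 (n + 1))) Qsystem_next //.
by field; rewrite !R_neq0 //; lia.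
Qed.

Lemma yweight_sum_next a n : (a < r)%N ->
  y (n + 1) a.+1.*2 + y (n + 1) a.+1.*2.+1 =
  R a.+1 n * R a.+2 (n + 1 + 1) / (R a.+1 (n + 1) * R a.+2 (n + 1)).
Proof.
move=> ar; rewrite yweight_odd yweight_even.
have Ra : R a.+2 (n + 1) != 0 by rewrite R_neq0.
rewrite -(mulKf Ra (R a (n + 1))) Qsystem_next ?(ltnW ar) //.
by field; rewrite !R_neq0 //; lia.
Qed.

Lemma yweight_mul a n : (a < r)%N ->
  y (n + 1) a.+1.*2.+1 * y n a.+1.*2 = y (n + 1) a.+1.*2 * y n a.*2.+1.
Proof.
move=> ar; rewrite !yweight_odd !yweight_even; field.
by rewrite !R_neq0 //; lia.
Qed.

Lemma hp_poly_time_evolution a n : (a <= r)%N ->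
  F a.+1 (n + 1) = F a.+1 n + y n a.+1.*2 *: 'X * F a n /\
  F a.+1 n = F a (n + 1) + y n a.*2.+1 *: 'X * F a n.
Proof.
apply: hp_poly_evolve => [|b br|b]; last exact: yweight_mul.
  by rewrite (@yweight_sum 0) // (@yweight_odd 0) !R0 mul1r mulr1 mul1r mulrC.
by rewrite yweight_sum_next // yweight_sum.
Qed.

Lemma hp_poly_conserved m n : F r.+1 m = F r.+1 n.
Proof.
apply: (int_shift_invariant (f := fun k => F r.+1 k)) => k.
have [-> _] := hp_poly_time_evolution k (leqnn r).
by rewrite yweight_even R_zero mulr0 mul0r scale0r mul0r addr0.
Qed.

Lemma pairing_evolve a n m : (a <= r)%N ->
  pairing (F a.+1 (n + 1)) m =
  pairing (F a.+1 n) m - y n a.+1.*2 * pairing (F a n) (m - 1).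
Proof.
move=> ar; have [-> _] := hp_poly_time_evolution n ar.
by rewrite shift_pairingD shift_pairing_scaleX mulNr.
Qed.

Lemma pairing_recr a n m : (a <= r)%N ->
  pairing (F a.+1 n) m =
  pairing (F a (n + 1)) m - y n a.*2.+1 * pairing (F a n) (m - 1).
Proof.
move=> ar; have [_ ->] := hp_poly_time_evolution n ar.
by rewrite shift_pairingD shift_pairing_scaleX mulNr.
Qed.

Lemma pairing_hp_poly_before a n : (a <= r.+1)%N ->
  pairing (F a n) n = (-1) ^+ a * R a.+1 n / R a n.
Proof.
elim: a n => [|a IH] n ar; first by rewrite shift_pairing1 R0 mul1r divr1.
have -> : n = n - 1 + 1 by rewrite subrK.
rewrite pairing_evolve // pairing_recr // addrK !IH ?(ltnW ar) //.
rewrite yweight_odd yweight_even exprS !subrK; field.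
by rewrite !R_neq0 //; lia.
Qed.

Lemma pairing_hp_poly_eq0 a n m : (a <= r.+1)%N -> n < m <= n + a%:Z ->
  pairing (F a n) m = 0.
Proof.
elim: a n m => [|a IH] n m ar nm; first by lia.
rewrite pairing_recr //; have [m_eq|m_neq] := eqVneq m (n + 1).
  rewrite m_eq addrK !pairing_hp_poly_before ?(ltnW ar) // yweight_odd; field.
  by rewrite !R_neq0 //; lia.
by rewrite !IH ?(ltnW ar) ?mulr0 ?subr0 //; lia.
Qed.

Lemma pairing_hp_poly_after a n : (a <= r.+1)%N ->
  pairing (F a n) (n + a%:Z + 1) = R a.+1 (n + 1) / R a n.
Proof.
elim: a n => [|a IH] n ar; first by rewrite shift_pairing1 R0 divr1 addr0.
have [next_eq pred_eq] : n + a.+1%:Z + 1 = n + 1 + a%:Z + 1 /\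
    n + a.+1%:Z + 1 - 1 = n + a%:Z + 1 by lia.
rewrite pairing_recr // pred_eq next_eq !IH ?(ltnW ar) // yweight_odd.
have Ra : R a (n + 1) != 0 by rewrite R_neq0 // ltnW.
rewrite -(mulfK Ra (R a.+2 (n + 1))) Qsystem_next //; field.
by rewrite !R_neq0 //; lia.
Qed.

Lemma det_hankel_Qsystem a s : (a <= r.+1)%N ->
  \det (hankel (R 1%N) s a a) = R a (s + a%:Z - 1).
Proof.
move=> ar.
rewrite (det_hankel_orthogonal (p := fun k => F k (s + k%:Z - 1))).
- have -> : R a (s + a%:Z - 1) = R a (s + a%:Z - 1) / R 0 (s + 0%:Z - 1).
    by rewrite R0 divr1.
  case: a ar => [|a] ar; first by rewrite big_ord0 R0 divr1.
  rewrite -(telescope_prodf (f := fun k => R k (s + k%:Z - 1))) // => [|k ka].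
    rewrite big_mkord; apply: eq_bigr => k _.
    have k_le : (k <= r.+1)%N by apply: ltnW (leq_trans (ltn_ord k) ar).
    have := pairing_hp_poly_after (s + k%:Z - 1) k_le.
    by congr (pairing _ _ = R _ _ / _); lia.
  by rewrite R_neq0 //; lia.
- by move=> k _; split; [exact: size_hp_poly | exact: coef0_hp_poly].
by move=> i k ik; apply: pairing_hp_poly_eq0; lia.
Qed.

Lemma cons_qty_hankel j m : cons_qty R r j m =
  \det (col' (inord (r.+1 - j)) (hankel (R 1%N) (m - r%:Z - 1) r.+1 r.+2)).
Proof.
by congr (\det _); apply/matrixP => i k; rewrite !mxE; congr R; lia.
Qed.

Lemma cons_qty_hp_poly m n j : (j <= r.+1)%N ->
  cons_qty R r j m = (F r.+1 n)`_j * R r.+1 (m - 1).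
Proof.
move=> jr; rewrite cons_qty_hankel (hp_poly_conserved n (m - 1)).
rewrite (det_col'_hankel (p := F r.+1 (m - 1))).
- rewrite inordK ?ltnS ?leq_subr // subKn // det_hankel_Qsystem //.
  by congr (_ * R _ _); lia.
- exact: size_hp_poly.
- exact: coef0_hp_poly.
by move=> i ir; apply: pairing_hp_poly_eq0; lia.
Qed.

End QSystem.

Theorem cons_qty_Zhard (K : fieldType) (r : nat) (R : nat -> int -> K) :
    (forall n, R 0%N n = 1) -> (forall n, R r.+1 n = 1) ->
    (forall a n, (a <= r.+1)%N -> R a n != 0) ->
    (forall a n, (1 <= a <= r)%N ->
       R a (n + 1) * R a (n - 1) = R a n ^+ 2 + R a.+1 n * R a.-1 n) ->
  forall (m n : int) (j : nat), (j <= r.+1)%N ->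
    cons_qty R r j m = Zhard r j (yweight R n).
Proof.
move=> R0 R_last R_neq0 R_rec m n j jr.
(* [R r.+2] is unconstrained: setting it to 0 extends the recursion to
   [a = r.+1]. *)
pose Q a k := if (a <= r.+1)%N then R a k else 0.
have QE a k : (a <= r.+1)%N -> Q a k = R a k by rewrite /Q => ->.
have -> : cons_qty R r j m = cons_qty Q r j m by [].
have -> : Zhard r j (yweight R n) = Zhard r j (yweight Q n).
  apply: eq_bigr => C _; apply: eq_bigr => v _; have := ltn_ord v.
  by rewrite /yweight; case: ifP => v_odd v_le; rewrite !QE //; lia.
rewrite Zhard_hp_poly (cons_qty_hp_poly (R := Q) _ _ _ _ m n) //.
- by rewrite QE // R_last mulr1.
- by move=> a k ar; rewrite QE ?R_neq0.
- by move=> k; rewrite /Q ltnn.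
move=> a k /andP[a_gt0]; rewrite leq_eqVlt ltnS => /predU1P[->|ar].
  by rewrite /Q /= leqnn ltnn !R_last mul0r addr0 expr1n mulr1.
by rewrite !QE ?R_rec ?a_gt0 //; lia.
Qed.

Theorem mainTheorem6 (r : nat) (hr : (1 <= r)%N)
  (R : nat -> int -> ratfun (2 * r))
  (Hinit0 : forall a : nat, (1 <= a <= r)%N -> R a 0 = xvar (2 * r) a.-1)
  (Hinit1 : forall a : nat, (1 <= a <= r)%N -> R a 1 = xvar (2 * r) (r + a.-1))
  (Hbd0 : forall n : int, R 0%N n = 1)
  (Hbdr : forall n : int, R r.+1 n = 1)
  (Hnz : forall (a : nat) (n : int), (a <= r.+1)%N -> R a n != 0)
  (Hrec : forall (a : nat) (n : int), (1 <= a <= r)%N ->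
            R a (n + 1) * R a (n - 1) = R a n ^+ 2 + R a.+1 n * R a.-1 n) :
  forall (m n : int) (j : nat), (j <= r.+1)%N ->
    cons_qty R r j m = Zhard r j (yweight R n).
Proof. exact: cons_qty_Zhard. Qed.
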